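(* For every $n\ge 3$, the group $\mathrm{Brun}(T_n)$ of Brunnian twins on $n$ strands is a free group.
   Context: For $n\ge 2$ the twin group $T_n$ is generated by $t_1,\dots,t_{n-1}$ with relations $t_i^2=1$ and $t_it_j=t_jt_i$ for $|i-j|\ge 2$; $T_1$ is trivial. Geometrically its elements (twins) are homotopy classes of configurations of $n$ monotone strands in $\mathbb R\times[0,1]$ joining $n$ marked points on $y=1$ to $n$ marked points on $y=0$, with no three strands through a common point; the product is stacking (left factor on top), and $t_i$ is the single crossing of the strands in positions $i,i+1$. For $u\in T_n$ let $\nu(u)\in S_n$ be the permutation such that the strand of $u$ starting at position $k$ ends at position $\nu(u)(k)$. The pure twin group $PT_n$ is the subgroup of all $u$ with $\nu(u)=1$. For $0\le i\le n-1$ the map $d_i:T_n\to T_{n-1}$ deletes the strand starting at position $i+1$; it is determined by $d_i(uw)=d_i(u)\,d_{\nu(u)(i+1)-1}(w)$ together with $d_i(t_j)=t_{j-1}$ if $i+1<j$, $d_i(t_j)=1$ if $i+1\in\{j,j+1\}$, and $d_i(t_j)=t_j$ if $i+1>j+1$. It restricts to a group homomorphism $PT_n\to PT_{n-1}$. A pure twin is Brunnian if it becomes trivial after removing any one of its strands, i.e. $\mathrm{Brun}(T_n)=\bigcap_{i=0}^{n-1}\ker(d_i:PT_n\to PT_{n-1})$. *)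

(* Defs.v *)
From HB Require Import structures.
From mathcomp Require Import all_boot all_fingroup generic_quotient.
From mathcomp Require Import boolp.
From mathcomp Require Import zify.

Set Implicit Arguments.
Unset Strict Implicit.
Unset Printing Implicit Defensive.

Local Open Scope quotient_scope.
Local Open Scope group_scope.

(* All indices are shifted down by one: positions of strands are the elements *)
(* of 'I_n, and the generator with index j : 'I_n.-1, which is t_(j+1) in the *)
(* usual numbering, crosses the strands in positions j and j+1 of 'I_n.       *)

(* Congruence on words in the generators. As each generator is its own        *)
(* inverse, words without formal inverses suffice; twin_univ below is the  *)
(* universal property of the group presentation.                              *)
Inductive twin_eq (n : nat) : seq 'I_n.-1 -> seq 'I_n.-1 -> Prop :=
| twin_eq_refl w : twin_eq w w
| twin_eq_sym w1 w2 : twin_eq w1 w2 -> twin_eq w2 w1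
| twin_eq_trans w1 w2 w3 : twin_eq w1 w2 -> twin_eq w2 w3 -> twin_eq w1 w3
| twin_eq_sqr w1 w2 (i : 'I_n.-1) : twin_eq (w1 ++ [:: i; i] ++ w2) (w1 ++ w2)
| twin_eq_comm w1 w2 (i j : 'I_n.-1) : (i + 2 <= j) || (j + 2 <= i) ->
    twin_eq (w1 ++ [:: i; j] ++ w2) (w1 ++ [:: j; i] ++ w2).

Section TwinGroup.
Variable n : nat.
Implicit Types u v w : seq 'I_n.-1.

Lemma twin_eq_catr u u' v : twin_eq u u' -> twin_eq (u ++ v) (u' ++ v).
Proof.
elim=> {u u'}.
- by move=> u; apply: twin_eq_refl.
- by move=> u u' _; apply: twin_eq_sym.
- by move=> u1 u2 u3 _ h12 _; apply: twin_eq_trans h12.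
- by move=> w1 w2 i; rewrite -!catA; apply: twin_eq_sqr.
- by move=> w1 w2 i j ij; rewrite -!catA; apply: twin_eq_comm.
Qed.

Lemma twin_eq_catl u v v' : twin_eq v v' -> twin_eq (u ++ v) (u ++ v').
Proof.
elim=> {v v'}.
- by move=> v; apply: twin_eq_refl.
- by move=> v v' _; apply: twin_eq_sym.
- by move=> u1 u2 u3 _ h12 _; apply: twin_eq_trans h12.
- by move=> w1 w2 i; rewrite !(catA u); apply: twin_eq_sqr.
- by move=> w1 w2 i j ij; rewrite !(catA u); apply: twin_eq_comm.
Qed.

Lemma twin_eq_cat u u' v v' :
  twin_eq u u' -> twin_eq v v' -> twin_eq (u ++ v) (u' ++ v').
Proof.
move=> uu' vv'; apply: (twin_eq_trans (twin_eq_catr v uu')).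
exact: twin_eq_catl.
Qed.

Lemma twin_eq_rev u v : twin_eq u v -> twin_eq (rev u) (rev v).
Proof.
elim=> {u v}.
- by move=> u; apply: twin_eq_refl.
- by move=> u v _; apply: twin_eq_sym.
- by move=> u1 u2 u3 _ h12 _; apply: twin_eq_trans h12.
- by move=> w1 w2 i; rewrite !rev_cat -catA; apply: twin_eq_sqr.
- move=> w1 w2 i j ij; rewrite !rev_cat -!catA; apply: twin_eq_comm.
  by rewrite orbC.
Qed.

Lemma twin_eq_revl w : twin_eq (rev w ++ w) [::].
Proof.
elim: w => [|i w IHw]; first exact: twin_eq_refl.
apply: twin_eq_trans IHw; rewrite rev_cons cat_rcons.
exact: (twin_eq_sqr (rev w) w i).
Qed.

Definition twin_eqb u v : bool := `[< twin_eq u v >].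

Lemma twin_eqb_refl : reflexive twin_eqb.
Proof. by move=> u; apply/asboolP/twin_eq_refl. Qed.

Lemma twin_eqb_sym : symmetric twin_eqb.
Proof. by move=> u v; apply/asboolP/asboolP; apply: twin_eq_sym. Qed.

Lemma twin_eqb_trans : transitive twin_eqb.
Proof.
by move=> v u w /asboolP uv /asboolP vw; apply/asboolP/(twin_eq_trans uv).
Qed.

Definition twin_equiv : equiv_rel (seq 'I_n.-1) :=
  EquivRel twin_eqb twin_eqb_refl twin_eqb_sym twin_eqb_trans.

Definition twin : Type := {eq_quot twin_equiv}.
HB.instance Definition _ := Choice.on twin.
HB.instance Definition _ := Quotient.on twin.

Definition twin_of_word (w : seq 'I_n.-1) : twin := \pi_twin w.

Lemma twin_of_wordP u v : twin_of_word u = twin_of_word v <-> twin_eq u v.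
Proof.
split=> [/eqmodP/asboolP //|uv]; apply/eqmodP; exact/asboolP.
Qed.

Lemma twin_of_wordK x : twin_of_word (repr (x : twin)) = x.
Proof. exact: reprK. Qed.

Lemma twin_eq_repr w : twin_eq (repr (twin_of_word w)) w.
Proof. by apply/twin_of_wordP/twin_of_wordK. Qed.

Definition twin_mul (x y : twin) : twin := twin_of_word (repr x ++ repr y).
Definition twin_inv (x : twin) : twin := twin_of_word (rev (repr x)).
Definition twin_one : twin := twin_of_word [::].

Lemma twin_of_word_cat u v :
  twin_of_word (u ++ v) = twin_mul (twin_of_word u) (twin_of_word v).
Proof.
by apply/twin_of_wordP/twin_eq_sym/twin_eq_cat; apply: twin_eq_repr.
Qed.

Lemma twin_mulA : associative twin_mul.
Proof.
move=> x y z; rewrite -[x]twin_of_wordK -[y]twin_of_wordK -[z]twin_of_wordK.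
by rewrite -!twin_of_word_cat catA.
Qed.

Lemma twin_mul1 : left_id twin_one twin_mul.
Proof. by move=> x; rewrite -[x]twin_of_wordK -twin_of_word_cat. Qed.

Lemma twin_1mul : right_id twin_one twin_mul.
Proof. by move=> x; rewrite -[x]twin_of_wordK -twin_of_word_cat cats0. Qed.

Lemma twin_mulV : left_inverse twin_one twin_inv twin_mul.
Proof.
move=> x; rewrite -[in X in twin_mul _ X](twin_of_wordK x) /twin_inv.
by rewrite -twin_of_word_cat; apply/twin_of_wordP/twin_eq_revl.
Qed.

Lemma twin_Vmul : right_inverse twin_one twin_inv twin_mul.
Proof.
move=> x; rewrite -[in X in twin_mul X _](twin_of_wordK x) /twin_inv.
rewrite -twin_of_word_cat -{1}[repr x]revK.
by apply/twin_of_wordP/twin_eq_revl.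
Qed.

HB.instance Definition _ := isGroup.Build twin
  twin_mulA twin_mul1 twin_1mul twin_mulV twin_Vmul.

Definition twin_gen (i : 'I_n.-1) : twin := twin_of_word [:: i].

Lemma twin_of_word1 : twin_of_word [::] = 1. Proof. by []. Qed.

Lemma twin_of_wordM u v :
  twin_of_word (u ++ v) = twin_of_word u * twin_of_word v.
Proof. exact: twin_of_word_cat. Qed.

Lemma twin_of_wordE w : twin_of_word w = \prod_(i <- w) twin_gen i.
Proof.
elim: w => [|i w IHw]; first by rewrite big_nil.
by rewrite big_cons -IHw -twin_of_wordM.
Qed.

Lemma twin_gen_sqr i : twin_gen i * twin_gen i = 1.
Proof.
by rewrite -twin_of_wordM; apply/twin_of_wordP/(twin_eq_sqr [::] [::] i).
Qed.

Lemma twin_gen_comm (i j : 'I_n.-1) : (i + 2 <= j) || (j + 2 <= i) ->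
  twin_gen i * twin_gen j = twin_gen j * twin_gen i.
Proof.
move=> ij; rewrite -!twin_of_wordM.
exact/twin_of_wordP/(twin_eq_comm [::] [::] ij).
Qed.

Lemma twin_univ (H : groupType) (g : 'I_n.-1 -> H) :
    (forall i, g i * g i = 1) ->
    (forall i j : 'I_n.-1, (i + 2 <= j) || (j + 2 <= i) ->
       g i * g j = g j * g i) ->
  exists phi : twin -> H,
    [/\ {morph phi : x y / x * y}, forall i, phi (twin_gen i) = g i
      & forall psi : twin -> H, {morph psi : x y / x * y} ->
          (forall i, psi (twin_gen i) = g i) -> psi =1 phi].
Proof.
move=> gg gC; pose ev w := \prod_(i <- w) g i.
have evE u v : twin_eq u v -> ev u = ev v.
  elim=> {u v} //.
  - by move=> u v w _ -> _ ->.
  - move=> w1 w2 i.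
    by rewrite /ev /= !(big_cat, big_cons) /= (mulgA (g i)) gg mul1g.
  - move=> w1 w2 i j ij; rewrite /ev /= !(big_cat, big_cons) /=.
    by rewrite (mulgA (g i)) (gC i j ij) !mulgA.
exists (fun x => ev (repr x)); split.
- move=> x y; rewrite -[x]twin_of_wordK -[y]twin_of_wordK -twin_of_wordM.
  by rewrite !(evE _ _ (twin_eq_repr _)) /ev big_cat.
- by move=> i; rewrite (evE _ _ (twin_eq_repr _)) /ev big_seq1.
move=> psi psiM psig x; rewrite -{1}[x]twin_of_wordK.
elim: (repr x) => [|i w IHw].
  rewrite /ev big_nil; apply: (mulgI (psi 1)).
  by rewrite twin_of_word1 -psiM !mulg1.
by rewrite -cat1s twin_of_wordM psiM IHw psig /ev big_cons.
Qed.

End TwinGroup.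

Section Permutation.
Variable n : nat.

Definition gen_left (j : 'I_n.-1) : 'I_n := widen_ord (leq_pred n) j.

Lemma gen_right_subproof (j : 'I_n.-1) : j.+1 < n.
Proof. by have := ltn_ord j; lia. Qed.

Definition gen_right (j : 'I_n.-1) : 'I_n := Ordinal (gen_right_subproof j).

Definition gen_perm (j : 'I_n.-1) : 'S_n := tperm (gen_left j) (gen_right j).

Definition nu_word (w : seq 'I_n.-1) : 'S_n := \prod_(j <- w) gen_perm j.

(* Products of permutations are read from left to right, (s * t) k = t (s k), *)
(* which is the stacking convention with the left factor on top.              *)
Definition nu (u : twin n) : 'S_n := nu_word (repr u).

Lemma val_gen_perm j (i : 'I_n) : gen_perm j i =
  (if i == j :> nat then j.+1 else if i == j.+1 :> nat then j : nat else i)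
  :> nat.
Proof.
rewrite permE /= -!val_eqE /=.
by case: eqP => // _; case: eqP.
Qed.

Lemma gen_perm_sqr j : gen_perm j * gen_perm j = 1.
Proof. exact: tperm2. Qed.

Lemma gen_perm_comm (i j : 'I_n.-1) : (i + 2 <= j) || (j + 2 <= i) ->
  gen_perm i * gen_perm j = gen_perm j * gen_perm i.
Proof.
move=> ij; apply/permP => k; apply: val_inj.
rewrite /= !permM !val_gen_perm.
case Ei: (k == i :> nat); case Ei1: (k == i.+1 :> nat);
  case Ej: (k == j :> nat); case Ej1: (k == j.+1 :> nat);
  by repeat (case: ifP => ?); lia.
Qed.

Lemma nu_word_eq u v : twin_eq u v -> nu_word u = nu_word v.
Proof.
elim=> {u v} //.
- by move=> u v w _ -> _ ->.
- move=> w1 w2 i.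
  by rewrite /nu_word /= !(big_cat, big_cons) /= (mulgA (gen_perm i))
    gen_perm_sqr mul1g.
- move=> w1 w2 i j ij; rewrite /nu_word /= !(big_cat, big_cons) /=.
  by rewrite (mulgA (gen_perm i)) (gen_perm_comm ij) !mulgA.
Qed.

Lemma nu_of_word w : nu (twin_of_word w) = nu_word w.
Proof. exact/nu_word_eq/twin_eq_repr. Qed.

Lemma nuM : {morph nu : u v / u * v}.
Proof.
move=> u v; rewrite -[u]twin_of_wordK -[v]twin_of_wordK -twin_of_wordM.
by rewrite !nu_of_word /nu_word big_cat.
Qed.

Lemma nu1 : nu 1 = 1.
Proof. by rewrite -twin_of_word1 nu_of_word /nu_word big_nil. Qed.

Lemma nu_gen j : nu (twin_gen j) = gen_perm j.
Proof. by rewrite nu_of_word /nu_word big_seq1. Qed.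

Definition pure_twin : {pred twin n} := [pred u | nu u == 1].

End Permutation.

(* twin_genn m k is the generator of index k; the value 1 for k >= m.-1 is    *)
(* never used by del_gen: see del_gen_lt_range and del_gen_gt_range.          *)
Definition twin_genn (m k : nat) : twin m :=
  if insub k is Some j then twin_gen j else 1.

Lemma twin_gennE m (j : 'I_m.-1) : twin_genn m j = twin_gen j.
Proof. by rewrite /twin_genn valK. Qed.

Lemma twin_genn_sqr m k : twin_genn m k * twin_genn m k = 1.
Proof.
by rewrite /twin_genn; case: insubP => [j _ _|_]; rewrite ?twin_gen_sqr ?mulg1.
Qed.

Lemma twin_genn_comm m k l : (k + 2 <= l) || (l + 2 <= k) ->
  twin_genn m k * twin_genn m l = twin_genn m l * twin_genn m k.
Proof.
rewrite /twin_genn; case: insubP => [i _ <-|_]; last by rewrite mulg1 mul1g.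
case: insubP => [j _ <-|_]; last by rewrite mulg1 mul1g.
exact: twin_gen_comm.
Qed.

Section Deletion.
Variable n : nat.
Implicit Types (i : 'I_n) (j : 'I_n.-1) (w : seq 'I_n.-1) (u v : twin n).

(* The crossing left after deleting the strand in position i above the        *)
(* crossing j.                                                                *)
Definition del_gen i j : twin n.-1 :=
  if i < j then twin_genn n.-1 j.-1
  else if (i == j :> nat) || (i == j.+1 :> nat) then 1
  else twin_genn n.-1 j.

Fixpoint del_word i w : twin n.-1 :=
  if w is j :: w' then del_gen i j * del_word (gen_perm j i) w' else 1.

Definition del i u : twin n.-1 := del_word i (repr u).

Lemma del_word_cat i w w' :
  del_word i (w ++ w') = del_word i w * del_word (nu_word w i) w'.
Proof.
elim: w i => [|j w IHw] i /=; first by rewrite mul1g /nu_word big_nil perm1.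
by rewrite IHw mulgA /nu_word big_cons permM.
Qed.

Lemma del_gen_sqr i j : del_gen i j * del_gen (gen_perm j i) j = 1.
Proof.
rewrite /del_gen val_gen_perm.
case Ej: (i == j :> nat); case Ej1: (i == j.+1 :> nat);
  repeat (case: ifP => ?); try (exfalso; lia);
  by rewrite ?mulg1 ?twin_genn_sqr.
Qed.

Lemma del_gen_comm i (j k : 'I_n.-1) : j + 2 <= k ->
  del_gen i j * del_gen (gen_perm j i) k
    = del_gen i k * del_gen (gen_perm k i) j.
Proof.
move=> jk; rewrite /del_gen !val_gen_perm.
have comm := @twin_genn_comm n.-1.
case Ej: (i == j :> nat); case Ej1: (i == j.+1 :> nat);
  case Ek: (i == k :> nat); case Ek1: (i == k.+1 :> nat);
  try (exfalso; lia);
  repeat (case: ifP => ?); try (exfalso; lia); rewrite ?mulg1 ?mul1g //;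
  by apply: comm; lia.
Qed.

Lemma del_word_eq i (u v : seq 'I_n.-1) :
  twin_eq u v -> del_word i u = del_word i v.
Proof.
move=> uv; elim: uv i => {u v}.
- by [].
- by move=> u v _ IH i; rewrite IH.
- by move=> u v w _ IH1 _ IH2 i; rewrite IH1 IH2.
- move=> w1 w2 j i; rewrite !del_word_cat /= mulg1 del_gen_sqr mul1g.
  by rewrite /nu_word big_cons big_seq1 gen_perm_sqr perm1.
- move=> w1 w2 j k jk i; rewrite !del_word_cat /= !mulg1.
  congr (_ * (_ * del_word _ _)); last first.
    by rewrite /nu_word !big_cons big_nil !mulg1 (gen_perm_comm jk).
  by case/orP: jk => jk; rewrite (del_gen_comm _ jk).
Qed.

Lemma del_of_word i w : del i (twin_of_word w) = del_word i w.
Proof. exact/del_word_eq/twin_eq_repr. Qed.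

Lemma delM i u v : del i (u * v) = del i u * del (nu u i) v.
Proof.
rewrite -[u]twin_of_wordK -[v]twin_of_wordK -twin_of_wordM.
by rewrite !del_of_word nu_of_word del_word_cat.
Qed.

Lemma del1 i : del i 1 = 1.
Proof. by rewrite -(twin_of_word1 n) del_of_word. Qed.

Lemma del_twin_gen i j : del i (twin_gen j) = del_gen i j.
Proof. by rewrite del_of_word /= mulg1. Qed.

Lemma del_gen_lt i j (k : 'I_n.-2) : i < j -> k.+1 = j ->
  del_gen i j = twin_gen k.
Proof. by move=> ij kj; rewrite /del_gen ij -kj twin_gennE. Qed.

Lemma del_gen_eq i j : i = j :> nat \/ i = j.+1 :> nat -> del_gen i j = 1.
Proof.
move=> ij; rewrite /del_gen (_ : i < j = false); last by lia.
by case: ij => ->; rewrite eqxx ?orbT.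
Qed.

Lemma del_gen_gt i j (k : 'I_n.-2) : j.+1 < i -> k = j :> nat ->
  del_gen i j = twin_gen k.
Proof.
move=> ij kj; rewrite /del_gen (_ : i < j = false); last by lia.
rewrite (_ : _ || _ = false) -?kj ?twin_gennE //; lia.
Qed.

Lemma del_gen_lt_range i j : i < j -> j.-1 < n.-2.
Proof. by have := ltn_ord j; lia. Qed.

Lemma del_gen_gt_range i j : j.+1 < i -> j < n.-2.
Proof. by have := ltn_ord i; lia. Qed.

End Deletion.

Lemma pure_twin_group_closed n : group_closed (@pure_twin n).
Proof.
split=> [|u v]; rewrite !inE ?nu1 // => /eqP uP /eqP vP.
have: nu (u * v^-1) * nu v = 1 by rewrite -nuM mulgVK.
by rewrite vP mulg1 => ->.
Qed.

Lemma delM_pure n i :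
  {in @pure_twin n &, {morph del i : u v / u * v}}.
Proof. by move=> u v /eqP uP _; rewrite delM uP perm1. Qed.

Lemma lift_del_gen n (i : 'I_n.+1) (j : 'I_n) (k : 'I_n) :
  lift (@gen_perm n.+1 j i) (nu (@del_gen n.+1 i j) k)
    = @gen_perm n.+1 j (lift i k).
Proof.
have hn := ltn_ord k; have hi := ltn_ord i; have hj := ltn_ord j.
have bumpE h l : bump h l = if h <= l then l.+1 else l.
  by rewrite /bump; case: (h <= l).
apply: val_inj; rewrite /= !val_gen_perm /= !bumpE.
have [ij|ij] := ltnP i j.
  have lt_j := del_gen_lt_range ij.
  have j1 : j.-1.+1 = j by apply: prednK; apply: leq_ltn_trans ij.
  rewrite (@del_gen_lt n.+1 i j (Ordinal lt_j)) //=.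
  rewrite nu_gen val_gen_perm /=.
  simpl in *; case Ej: (i == j :> nat); case Ej1: (i == j.+1 :> nat);
    case Ek: (i <= k);
    case Ekj: (k == j.-1 :> nat); case Ekj1: (k == j.-1.+1 :> nat);
    case Ekj2: (k == j :> nat); case Ekj3: (k == j.+1 :> nat);
    by repeat (case: ifP => ?); lia.
have [ij1|ij1] := ltnP j.+1 i.
  have gt_j := del_gen_gt_range ij1.
  rewrite (@del_gen_gt n.+1 i j (Ordinal gt_j)) //=.
  rewrite nu_gen val_gen_perm /=.
  simpl in *; case Ej: (i == j :> nat); case Ej1: (i == j.+1 :> nat);
    case Ek: (i <= k);
    case Ekj: (k == j.-1 :> nat); case Ekj1: (k == j.-1.+1 :> nat);
    case Ekj2: (k == j :> nat); case Ekj3: (k == j.+1 :> nat);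
    by repeat (case: ifP => ?); lia.
rewrite del_gen_eq; last by simpl in *; lia.
rewrite nu1 perm1.
simpl in *; case Ej: (i == j :> nat); case Ej1: (i == j.+1 :> nat);
  case Ek: (i <= k);
    case Ekj: (k == j.-1 :> nat); case Ekj1: (k == j.-1.+1 :> nat);
    case Ekj2: (k == j :> nat); case Ekj3: (k == j.+1 :> nat);
  by repeat (case: ifP => ?); lia.
Qed.

(* del i u is the configuration of the strands of u other than the one        *)
(* starting at position i.                                                    *)
Lemma nu_del n (i : 'I_n.+1) (u : twin n.+1) (k : 'I_n) :
  lift (nu u i) (nu (del i u) k) = nu u (lift i k).
Proof.
rewrite -[u]twin_of_wordK nu_of_word del_of_word.
elim: (repr u) i k => [|j w IHw] i k.
  by rewrite /= nu1 /nu_word big_nil !perm1.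
rewrite /nu_word big_cons -/(nu_word w) !permM /= nuM permM IHw.
by rewrite lift_del_gen.
Qed.

Lemma del_pure n (i : 'I_n) (u : twin n) :
  u \in @pure_twin n -> del i u \in @pure_twin n.-1.
Proof.
case: n => [|n] in i u *; first by case: i.
move=> /eqP u1; apply/eqP/permP => k; apply: (@lift_inj _ i).
by have := nu_del i u k; rewrite u1 !perm1.
Qed.

Definition brun_twin_pred n : {pred twin n} :=
  [pred u in @pure_twin n | [forall i, del i u == 1]].

Lemma brun_twin_group_closed n : group_closed (@brun_twin_pred n).
Proof.
split=> [|u v].
  by rewrite inE /= inE nu1 eqxx; apply/forallP => i; rewrite del1.
move=> /andP[uP /forallP ud] /andP[vP /forallP vd].
have uvP : u * v^-1 \in @pure_twin n by apply: (pure_twin_group_closed n).2.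
apply/andP; split=> //; apply/forallP => i.
have: del i (u * v^-1) * del i v = 1.
  by rewrite -delM_pure // mulgVK; apply/eqP.
by rewrite (eqP (vd i)) mulg1 => /eqP.
Qed.

Record Brun (n : nat) := MkBrun {
  brun_val :> twin n;
  brun_valP : brun_val \in @brun_twin_pred n
}.

HB.instance Definition _ n := [isSub for @brun_val n].
HB.instance Definition _ n := [Choice of Brun n by <:].
HB.instance Definition _ n := SubChoice_isSubGroup.Build
  (twin n) (@brun_twin_pred n) (Brun n) (@brun_twin_group_closed n).

Lemma brun_valM n : {morph @brun_val n : x y / x * y}.
Proof. by []. Qed.

(* The family b is a basis of G (universal property of free groups).          *)
Definition free_group (G : groupType) : Prop :=
  exists (X : Type) (b : X -> G),
    forall (H : groupType) (f : X -> H),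
      exists! phi : G -> H,
        {morph phi : x y / x * y} /\ (forall x : X, phi (b x) = f x).

(* Main.v *)
Require Import Defs.
From mathcomp Require Import all_boot all_fingroup generic_quotient.
From mathcomp Require Import boolp classical_sets.
From mathcomp Require Import zmodp zify.

Set Implicit Arguments.
Unset Strict Implicit.
Unset Printing Implicit Defensive.

(** Fix a generator [t = t_tau] of [W = T_n].  Let [A] be generated by the other
    generators and [C <= A] by those that commute with [t].  The presentation
    of [W] is that of the amalgam of [A] and [C x <t>] over [C], so [W] acts on
    the Bass-Serre tree of this splitting.  The vertices with stabiliser
    conjugate to [C x <t>] have valency 2; without them, the tree has vertex
    set [W / A] and an oriented edge from [uA] to [utA] for each [uC] in
    [W / C], the reverse of which is given by [utC].

    Let [tau] be the last generator.  Brunnian twins act freely on this tree.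
    If a Brunnian [h] fixes the vertex [uA], then [h = u a u^-1] with [a] in
    [A = T_(n-1)], so the last strand of [a] is straight.  It continues a
    strand of [u]; deleting that strand from [h u = u a] shows that [a]
    becomes trivial without its last strand, and since that deletion is
    injective on [A], [a = 1] ([Brun_vertex_free]).  No pure twin reverses an
    edge, because [t c] with [c] in [C] is never pure ([pure_not_crossing]).

    A group acting freely on a tree is free ([free_of_free_action]).  Instead
    of paths in a tree, the proof uses integration: a function [c] on oriented
    edges, with values in a group and inverted by reversal of edges, is the
    derivative of a unique function on vertices equal to 1 at the base vertex
    [A] ([primitive_exists], [primitive_unique]).  In terms of words this says
    that the product of the values of [c] along a word respects the relations
    of [W].

    Every vertex is joined by a [G]-equivariant descent to some vertex [hA] of
    the orbit of the base vertex; call this [h] in [G] the basin of the vertex.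
    The vertices of basin 1 span a subtree that meets each orbit exactly once.
    The jump of an edge is the quotient of the basins of its ends, so it is 1
    exactly on the translates of edges of that subtree.  The basis of [G]
    consists of the jumps other than 1, one from each pair of inverses.  Given
    values of a homomorphism on the basis, extend them to all jumps; this is a
    [G]-invariant function on edges, and its primitive, restricted to the orbit
    of the base vertex, is the desired homomorphism ([extension]).  Conversely
    a homomorphism composed with the basin is a primitive, which gives
    uniqueness.  *)

(** * Homomorphisms of groups *)

Section Morphisms.
Local Open Scope group_scope.
Variables (G H : groupType) (f : G -> H).
Hypothesis fM : {morph f : x y / x * y}.

Lemma morph_one : f 1 = 1.
Proof. by apply: (mulgI (f 1)); rewrite -fM !mulg1. Qed.

Lemma morph_inv x : f x^-1 = (f x)^-1.
Proof. by apply: (mulgI (f x)); rewrite -fM !mulgV morph_one. Qed.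

End Morphisms.

(** * Standard subgroups of the twin group *)

Section Words.
Local Open Scope group_scope.
Variable n : nat.
Implicit Types (p : pred 'I_n.-1) (u v : twin n) (j : 'I_n.-1).
Implicit Types (w : seq 'I_n.-1).

Lemma twin_of_word_rcons w j :
  twin_of_word (rcons w j) = twin_of_word w * twin_gen j.
Proof. by rewrite -cats1 twin_of_wordM. Qed.

(** The standard parabolic subgroup of the Coxeter group [twin n] on the
    generators satisfying [p]. *)
Definition standard (p : pred 'I_n.-1) (u : twin n) : Prop :=
  exists2 w, all p w & u = twin_of_word w.

Lemma standard1 p : standard p 1.
Proof. by exists [::]. Qed.

Lemma standard_gen p j : p j -> standard p (twin_gen j).
Proof. by move=> pj; exists [:: j]; rewrite //= pj. Qed.

Lemma standardM p u v : standard p u -> standard p v -> standard p (u * v).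
Proof.
move=> [w pw ->] [w' pw' ->]; exists (w ++ w'); first by rewrite all_cat pw.
by rewrite twin_of_wordM.
Qed.

Lemma standardV p u : standard p u -> standard p u^-1.
Proof.
case=> w pw ->; exists (rev w); first by rewrite all_rev.
apply: mulg1_eq; rewrite -twin_of_wordM -{1}[w]revK.
exact/twin_of_wordP/twin_eq_revl.
Qed.

Lemma twin_ind (Q : twin n -> Prop) :
  Q 1 -> (forall u j, Q u -> Q (u * twin_gen j)) -> forall u, Q u.
Proof.
move=> Q1 QM u; rewrite -[u]twin_of_wordK.
by elim/last_ind: (repr u) => // w j; rewrite twin_of_word_rcons; apply: QM.
Qed.

Lemma standard_invariant (T : Type) (F : twin n -> T) p :
    (forall u j, p j -> F (u * twin_gen j) = F u) ->
  forall u a, standard p a -> F (u * a) = F u.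
Proof.
move=> FM u _ [w + ->]; elim/last_ind: w => [|w j IHw]; first by rewrite mulg1.
by rewrite all_rcons twin_of_word_rcons mulgA => /andP[pj /IHw <-]; apply: FM.
Qed.

End Words.

(** * Integration along the tree of a splitting *)

Section Splitting.
Local Open Scope group_scope.
Variables (n : nat) (tau : 'I_n.-1).
Implicit Types (u v : twin n) (j : 'I_n.-1) (w : seq 'I_n.-1).

(** The generators of the vertex group [A] and of the edge group [C] in the
    splitting at [tau]. *)
Definition other : pred 'I_n.-1 := [pred j | j != tau].
Definition apart : pred 'I_n.-1 :=
  [pred j : 'I_n.-1 | (j + 2 <= tau)%N || (tau + 2 <= j)%N].

Lemma apart_other j : apart j -> other j.
Proof. by rewrite /apart /= => h; apply/eqP => E; rewrite E in h; lia. Qed.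

Lemma standard_apart_comm a :
  standard apart a -> twin_gen tau * a = a * twin_gen tau.
Proof.
case=> w + ->; elim: w => [|j w IHw] /=; first by rewrite mulg1 mul1g.
case/andP=> pj /IHw E; rewrite -cat1s twin_of_wordM mulgA.
rewrite (_ : twin_of_word [:: j] = twin_gen j) // (twin_gen_comm (i := tau)).
  by rewrite -mulgA E mulgA.
by rewrite orbC.
Qed.

Section Integration.
Variables (H : groupType) (c : twin n -> H).

(** [P] is a function on the vertices [uA], normalised at the base vertex, that
    changes by [c u] along the edge from [uA] to [utA]. *)
Definition is_primitive (P : twin n -> H) : Prop :=
  [/\ P 1 = 1, forall u j, other j -> P (u * twin_gen j) = P u
    & forall u, P (u * twin_gen tau) = P u * c u].

Lemma primitive_unique P Q : is_primitive P -> is_primitive Q -> P =1 Q.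
Proof.
move=> [P1 Po Pt] [Q1 Qo Qt] u; elim/twin_ind: u => [|u j IHu].
  by rewrite P1.
have [->|jt] := eqVneq j tau; first by rewrite Pt Qt IHu.
by rewrite Po // Qo.
Qed.

(* [c] is a function on the edges [uC], inverted when an edge is reversed. *)
Hypothesis c_flip : forall u, c u * c (u * twin_gen tau) = 1.
Hypothesis c_apart : forall u j, apart j -> c (u * twin_gen j) = c u.

(** The product of the values of [c] along the path from the vertex [uA] that
    spells the word: only the letter [tau] moves to another vertex. *)
Fixpoint integral u w : H :=
  if w is j :: w' then (if j == tau then c u else 1)
    * integral (u * twin_gen j) w' else 1.

Lemma integral_cat u w w' :
  integral u (w ++ w') = integral u w * integral (u * twin_of_word w) w'.
Proof.
elim: w u => [|j w IHw] u /=; first by rewrite mul1g mulg1.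
by rewrite IHw -[j :: w]cat1s twin_of_wordM !mulgA.
Qed.

(** This is where the presentation enters, in place of the absence of cycles in
    the tree: a square [t t] goes along an edge and back, and a generator that
    commutes with [t] leaves the edge [uC] unchanged. *)
Lemma integral_eq u w w' : twin_eq w w' -> integral u w = integral u w'.
Proof.
move=> ww'; elim: ww' u => {w w'}.
- by [].
- by move=> w w' _ IH u; rewrite IH.
- by move=> w1 w2 w3 _ IH1 _ IH2 u; rewrite IH1.
- move=> w1 w2 j u; rewrite !integral_cat /= mulg1.
  rewrite (_ : twin_of_word [:: j; j] = 1); last first.
    by rewrite twin_of_wordE big_cons big_seq1 twin_gen_sqr.
  rewrite mulg1; case: eqP => [->|_]; first by rewrite c_flip mul1g.
  by rewrite !mul1g.
move=> w1 w2 i j ij u; rewrite !integral_cat /= !mulg1.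
have E : twin_of_word [:: i; j] = twin_of_word [:: j; i] :> twin n.
  by rewrite !twin_of_wordE !big_cons !big_nil !mulg1 (twin_gen_comm ij).
rewrite E; congr (_ * (_ * _)).
have nij : i != j by apply/eqP => e; move: ij; rewrite e; lia.
case: (eqVneq i tau) => [it|it]; case: (eqVneq j tau) => [jt|jt].
- by rewrite it jt eqxx in nij.
- by rewrite mul1g mulg1 c_apart // /apart /= -it; move: ij; rewrite orbC.
- by rewrite mul1g mulg1 c_apart // /apart /= -jt; move: ij.
- by [].
Qed.

Lemma primitive_exists : exists P, is_primitive P.
Proof.
pose P (u : twin n) := integral 1 (repr u).
have PE w : P (twin_of_word w) = integral 1 w.
  exact/integral_eq/twin_eq_repr.
have PM u j : P (u * twin_gen j) = P u * (if j == tau then c u else 1).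
  rewrite -{1 3}[u]twin_of_wordK -twin_of_wordM PE integral_cat /= !mulg1.
  by rewrite mul1g -/(P u) twin_of_wordK.
exists P; split; first exact: (PE [::]).
  by move=> u j /negPf jt; rewrite PM jt mulg1.
by move=> u; rewrite PM eqxx.
Qed.

End Integration.

(** * Subgroups acting freely on the tree *)

Section FreeAction.
Variables (G : groupType) (val : G -> twin n).
Hypothesis valM : {morph val : x y / x * y}.
(* [G] meets no conjugate of [A], so that it acts freely on the vertices, and no
   element of [G] reverses an edge. *)
Hypothesis vertex_free :
  forall h u a, standard other a -> val h * u = u * a -> h = 1.
Hypothesis edge_free :
  forall h u a, standard apart a -> val h * u <> u * (twin_gen tau * a).
Local Notation t := (twin_gen tau).
Implicit Types (g h : G).

Let val1 : val 1 = 1 := morph_one valM.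
Let valV h : val h^-1 = (val h)^-1 := morph_inv valM h.

(** The words representing an element of the double coset [G u A], that is, of
    the [G]-orbit of the vertex [uA]. *)
Definition orbit_word u w : Prop :=
  exists h a, standard other a /\ u = val h * twin_of_word w * a.

Definition shortest (Q : seq 'I_n.-1 -> Prop) : set (seq 'I_n.-1) :=
  [set w | Q w /\ forall w', Q w' -> (size w <= size w')%N].

(** The choice of a shortest word depends on the orbit only, since equivalent
    predicates are equal: this makes the descent below equivariant. *)
Definition orbit_rep u : seq 'I_n.-1 := xget [::] (shortest (orbit_word u)).

Lemma orbit_word_invariant h u a : standard other a ->
  orbit_word (val h * u * a) = orbit_word u.
Proof.
move=> oa; apply/funext => w; apply/propext; split=> -[g [b [ob E]]].
  exists (h^-1 * g), (b * a^-1); split; first exact/standardM/standardV.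
  by rewrite valM valV -!mulgA (mulgA (twin_of_word w)) (mulgA (val g))
    (mulgA (val g)) -E mulgK mulKg.
exists (h * g), (b * a); split; first exact: standardM.
by rewrite E valM !mulgA.
Qed.

Lemma orbit_rep_invariant h u a : standard other a ->
  orbit_rep (val h * u * a) = orbit_rep u.
Proof. by move=> oa; rewrite /orbit_rep orbit_word_invariant. Qed.

Lemma orbit_repP u : shortest (orbit_word u) (orbit_rep u).
Proof.
apply: xgetPex.
pose p k := `[< exists2 w, orbit_word u w & size w = k >].
have p_ex : exists k, p k.
  exists (size (repr u)); apply/asboolP; exists (repr u) => //.
  exists 1, 1; split; first exact: standard1.
  by rewrite val1 mul1g mulg1 twin_of_wordK.
case: (ex_minnP p_ex) => k /asboolP[w uw <-] wmin.
by exists w; split=> // w' uw'; apply: wmin; apply/asboolP; exists w'.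
Qed.

Definition level u := size (orbit_rep u).

Lemma level_le u w : orbit_word u w -> (level u <= size w)%N.
Proof. exact: (orbit_repP u).2. Qed.

Lemma level_invariant h u a : standard other a ->
  level (val h * u * a) = level u.
Proof. by move=> oa; rewrite /level orbit_rep_invariant. Qed.

Lemma carrier_exists u : exists h, exists2 a, standard other a
  & u = val h * twin_of_word (orbit_rep u) * a.
Proof. by have [[h [a [oa E]]] _] := orbit_repP u; exists h, a. Qed.

(** The element of [G] that carries the chosen vertex of the orbit to [uA]; it
    is unique because the action on vertices is free. *)
Definition carrier u : G := projT1 (cid (carrier_exists u)).

Lemma carrierP u : exists2 a, standard other a
  & u = val (carrier u) * twin_of_word (orbit_rep u) * a.
Proof. by rewrite /carrier; case: cid. Qed.

Lemma vertex_inj h h' v a a' : standard other a -> standard other a' ->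
  val h * v * a = val h' * v * a' -> h = h'.
Proof.
move=> oa oa' E; apply/esym/eqP; rewrite -(inj_eq (mulgI h'^-1)) mulVg eq_sym.
apply/eqP/(@vertex_free _ v (a' * a^-1)); first exact/standardM/standardV.
apply: (mulIg a); rewrite -!mulgA mulVg mulg1 valM valV -mulgA (mulgA (val h)).
by rewrite E -mulgA mulKg.
Qed.

Lemma carrier_equivariant h u a : standard other a ->
  carrier (val h * u * a) = h * carrier u.
Proof.
move=> oa; have [b ob E] := carrierP (val h * u * a).
have [d od E'] := carrierP u.
apply: (vertex_inj (v := twin_of_word (orbit_rep u)) ob (standardM od oa)).
by rewrite orbit_rep_invariant // in E; rewrite -E {1}E' valM !mulgA.
Qed.

(** A shortest word of positive length in [G u A] ends with [t], as any other
    last letter could be absorbed by [A].  Without this letter it represents a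
    neighbour of the chosen vertex; the carrier translates this neighbour to a
    neighbour of [uA] in an orbit of smaller level. *)
Definition descend u : twin n :=
  val (carrier u) * twin_of_word (take (level u).-1 (orbit_rep u)).

Lemma descend_equivariant h u a : standard other a ->
  descend (val h * u * a) = val h * descend u.
Proof.
move=> oa; rewrite /descend carrier_equivariant // level_invariant //.
by rewrite orbit_rep_invariant // valM mulgA.
Qed.

Lemma level_descend u : (level (descend u) <= (level u).-1)%N.
Proof.
set w := take (level u).-1 (orbit_rep u).
have <- : size w = (level u).-1 by rewrite size_takel // leq_pred.
apply: level_le; exists (carrier u), 1; split; first exact: standard1.
by rewrite mulg1.
Qed.

Lemma descend_adjacent u : (0 < level u)%N ->
  exists2 a, standard other a & descend u * t = u * a.
Proof.
rewrite /descend /level; case: (carrierP u) => a oa.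
have [_ rep_min] := orbit_repP u.
case/lastP: (orbit_rep u) rep_min => [//|w j] rep_min E _.
have jt : j = tau.
  apply/eqP; apply: contraTT isT => jt.
  have /rep_min : orbit_word u w.
    exists (carrier u), (twin_gen j * a); split.
      exact/standardM/oa/standard_gen.
    by rewrite {1}E twin_of_word_rcons !mulgA.
  by rewrite size_rcons ltnn.
exists a^-1; first exact: standardV.
rewrite {2}E mulgK size_rcons /= -cats1 take_size_cat //.
by rewrite twin_of_wordM jt mulgA.
Qed.

Lemma level_one : level 1 = 0.
Proof.
apply/eqP; rewrite -leqn0; apply: (@level_le 1 [::]).
exists 1, 1; split; first exact: standard1.
by rewrite val1 twin_of_word1 !mulg1.
Qed.

Lemma carrier_val h : carrier (val h) = h.
Proof.
have [a oa] := carrierP (val h).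
have l0 : level (val h) = 0.
  rewrite -[val h]mulg1 -[val h * 1]mulg1 level_invariant ?level_one //.
  exact: standard1.
rewrite (size0nil l0) => E; apply/esym/(vertex_inj (v := 1) (standard1 _) oa).
by rewrite mulg1 mulg1.
Qed.

Lemma descend_level0 u : level u = 0 -> descend u = val (carrier u).
Proof. by move=> l0; rewrite /descend l0 take0 mulg1. Qed.

(** Level 0 means that [uA] is a translate of the base vertex, by the carrier of
    [u].  On such [u] the descent stops up to [A], so that more than [level u]
    iterations give the same result ([basin_iter]). *)
Definition basin u : G := carrier (iter (level u) descend u).

Lemma basin_iter m u : (level u <= m)%N ->
  carrier (iter m descend u) = basin u.
Proof.
have lev k : (level (iter k descend u) <= level u - k)%N.
  elim: k => [|k IHk]; first by rewrite subn0.
  by rewrite iterS; apply: leq_trans (level_descend _) _; lia.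
move/subnK <-; elim: (m - level u)%N => [//|k IHk].
rewrite addSn iterS descend_level0 ?carrier_val //.
by apply/eqP; rewrite -leqn0; apply: leq_trans (lev _) _; lia.
Qed.

Lemma basin_descend u : basin (descend u) = basin u.
Proof.
rewrite -(@basin_iter (level u).+1 u) ?leqnSn // iterSr basin_iter //.
by apply: leq_trans (level_descend u) _; lia.
Qed.

Lemma basinMl h u : basin (val h * u) = h * basin u.
Proof.
have hE v : val h * v = val h * v * 1 by rewrite mulg1.
rewrite /basin {1}hE level_invariant; last exact: standard1.
rewrite (_ : iter _ _ _ = val h * iter (level u) descend u).
  by rewrite hE carrier_equivariant //; exact: standard1.
elim: (level u) => [//|k IHk]; rewrite !iterS IHk {1}hE.
by rewrite descend_equivariant //; exact: standard1.
Qed.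

Lemma basinMr u a : standard other a -> basin (u * a) = basin u.
Proof.
move=> oa; have E : u * a = val 1 * u * a by rewrite val1 mul1g.
rewrite -(@basin_iter (level u).+1 u) ?leqnSn //.
rewrite -(@basin_iter (level u).+1 (u * a)); last first.
  by rewrite E level_invariant.
by rewrite !iterSr E descend_equivariant // val1 mul1g.
Qed.

Lemma basin_val h : basin (val h) = h.
Proof.
have c1 : carrier 1 = 1 by have := carrier_val 1; rewrite val1.
by rewrite -[val h]mulg1 basinMl /basin level_one /= c1 mulg1.
Qed.

Lemma level0_basin u : level u = 0 ->
  exists2 a, standard other a & u = val (basin u) * a.
Proof.
move=> l0; have [a oa E] := carrierP u; exists a => //.
by rewrite {1}E /basin l0 (size0nil l0) mulg1.
Qed.

Definition jump u : G := (basin u)^-1 * basin (u * t).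

Lemma jumpMl h u : jump (val h * u) = jump u.
Proof. by rewrite /jump -mulgA !basinMl invMg mulgA mulgVK. Qed.

Lemma jump_flip u : jump (u * t) = (jump u)^-1.
Proof. by rewrite /jump invMg invgK -mulgA twin_gen_sqr mulg1. Qed.

Lemma jump_apart u a : standard apart a -> jump (u * a) = jump u.
Proof.
move=> pa; rewrite /jump -mulgA -(standard_apart_comm pa) mulgA.
have oa : standard other a.
  by case: pa => w pw ->; exists w => //; apply: sub_all pw; exact: apart_other.
by rewrite !(basinMr _ oa).
Qed.

(** Homomorphisms on [G] come from [G]-invariant functions on edges.  The last
    hypothesis says that [c] is trivial on the translates of the spanning
    subtree of basin 1. *)
Section Extension.
Variables (H : groupType) (c : twin n -> H).
Hypothesis c_equiv : forall h u, c (val h * u) = c u.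
Hypothesis c_flip : forall u, c (u * t) = (c u)^-1.
Hypothesis c_apart : forall u j, apart j -> c (u * twin_gen j) = c u.
Hypothesis c_tree : forall u, jump u = 1 -> c u = 1.

(** The descent from a vertex of basin 1 stays in this basin until it reaches the
    base vertex, and [c] is trivial along it. *)
Lemma primitive_basin P u : is_primitive c P -> basin u = 1 -> P u = 1.
Proof.
case=> P1 Po Pt; have Pa := standard_invariant Po.
have [k] := ubnP (level u); elim: k u => // k IHk u ltuk bu.
have [l0|lpos] := posnP (level u).
  by have [a oa ->] := level0_basin l0; rewrite bu val1 Pa.
have [a oa E] := descend_adjacent lpos.
have bd : basin (descend u) = 1 by rewrite basin_descend.
rewrite -(Pa _ _ oa) -E Pt IHk //; last first.
  by have := level_descend u; lia.
by rewrite mul1g c_tree // /jump bd E basinMr // bu mulg1 invg1.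
Qed.

(** By invariance of [c] the primitive [P] satisfies [P (h u) = P h * P u] for
    [h] in [G].  It is therefore multiplicative on [G], and by
    [primitive_basin] its value at [u] depends on the basin of [u] only. *)
Lemma extension : exists2 phi : G -> H,
  {morph phi : x y / x * y} & forall u, phi (jump u) = c u.
Proof.
have cc u : c u * c (u * t) = 1 by rewrite c_flip mulgV.
have [P PP] := primitive_exists cc c_apart; have [P1 Po Pt] := PP.
have PM h u : P (val h * u) = P (val h) * P u.
  rewrite -[LHS](mulVKg (P (val h))); congr (_ * _).
  apply: (primitive_unique (P := fun u => (P (val h))^-1 * P (val h * u)) _ PP).
  split=> [|v j oj|v]; first by rewrite mulg1 mulVg.
    by rewrite mulgA Po.
  by rewrite mulgA Pt c_equiv mulgA.
have Pbasin u : P u = P (val (basin u)).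
  have b1 : basin (val (basin u)^-1 * u) = 1 by rewrite basinMl mulVg.
  rewrite -{1}[u](mulVKg (val (basin u))) PM -valV.
  by rewrite (primitive_basin PP b1) mulg1.
exists (fun h => P (val h)) => [h h'|u]; first by rewrite valM PM.
apply: (mulgI (P (val (basin u)))); rewrite -PM -valM /jump mulVKg.
by rewrite -!Pbasin Pt.
Qed.

End Extension.

(** The function that is [z] on the [G]-orbit of the edge [u], [z^-1] on the
    reversed edges and 1 elsewhere is well defined because no edge is reversed.
    It extends to a homomorphism sending [jump u] to [z], and it remains to
    take [z] with [z != z^-1], for instance of order 3. *)
Lemma jump_torsion u : jump u != 1 -> jump u != (jump u)^-1.
Proof.
move=> ju1; pose E v := `[< exists h a, standard apart a /\ v = val h * u * a >].
have E_inv h v a : standard apart a -> E (val h * v * a) = E v.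
  move=> pa; apply/asboolP/asboolP => -[g [b [pb e]]].
    exists (h^-1 * g), (b * a^-1); split; first exact/standardM/standardV.
    by rewrite valM valV -!mulgA (mulgA u) (mulgA (val g)) (mulgA (val g))
      -e mulgK mulKg.
  exists (h * g), (b * a); split; first exact: standardM.
  by rewrite e valM !mulgA.
have E_jump v : E v -> jump v = jump u.
  by case/asboolP=> h [a [pa ->]]; rewrite jump_apart // jumpMl.
have E_flip v : E v -> ~~ E (v * t).
  case/asboolP=> h [a [pa ->]]; apply/negP => /asboolP[g [b [pb e]]].
  apply: (@edge_free (h^-1 * g) u (a * b^-1)).
    exact/standardM/standardV.
  apply: (mulIg b); rewrite -!mulgA mulVg mulg1 valM valV -mulgA.
  by rewrite (mulgA (val g)) -e -!mulgA mulKg standard_apart_comm.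
pose z : 'I_3 := inord 1.
have zz : z != z^-1 by rewrite -val_eqE /= inordK.
pose c v : 'I_3 := if E v then z else if E (v * t) then z^-1 else 1.
have c_flip v : c (v * t) = (c v)^-1.
  rewrite /c -mulgA twin_gen_sqr mulg1.
  have [Ev|nEv] := boolP (E v); first by rewrite (negPf (E_flip _ Ev)).
  by case: ifP; rewrite ?invgK ?invg1.
have [||||phi phiM phi_jump] := @extension 'I_3 c.
- move=> h v; rewrite /c -mulgA; have e1 := standard1 apart.
  by rewrite -[val h * v]mulg1 -[val h * (v * t)]mulg1 !E_inv.
- exact: c_flip.
- move=> v j pj; have oj := standard_gen pj.
  have Ej v' : E (v' * twin_gen j) = E v'.
    by rewrite -(E_inv 1 v' _ oj) val1 mul1g.
  by rewrite /c Ej -mulgA -(standard_apart_comm oj) mulgA Ej.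
- move=> v jv; rewrite /c ifN; last first.
    by apply: contraNN ju1 => /E_jump <-; rewrite jv.
  rewrite ifN //; apply: contraNN ju1 => /E_jump <-.
  by rewrite jump_flip jv invg1.
have Eu : E u.
  by apply/asboolP; exists 1, 1; split; rewrite ?val1 ?mul1g ?mulg1 //;
     exact: standard1.
have cu : c u = z by rewrite /c Eu.
apply: contraNN zz => /eqP ju.
by rewrite -cu -phi_jump {1}ju (morph_inv phiM).
Qed.

(** The basis: [choose] depends only on the pair formed by [x] and its inverse,
    and so selects one of them. *)
Definition positive_jump : pred G :=
  [pred x | [&& `[< exists u, jump u = x >], x != 1
              & choose (pred2 x x^-1) x == x]].

Lemma positive_jump_cases u :
  [\/ jump u = 1, positive_jump (jump u) | positive_jump (jump u)^-1].
Proof.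
have [|j1] := eqVneq (jump u) 1; first exact: Or31.
have: pred2 (jump u) (jump u)^-1 (choose (pred2 (jump u) (jump u)^-1) (jump u)).
  by apply: chooseP; rewrite /= eqxx.
case/orP=> /eqP E; [apply: Or32 | apply: Or33]; apply/and3P; split.
- by apply/asboolP; exists u.
- by [].
- by rewrite E.
- by apply/asboolP; exists (u * t); rewrite jump_flip.
- by rewrite invg_eq1.
rewrite invgK -[X in _ == X]E; apply/eqP.
rewrite (@eq_choose _ _ (pred2 (jump u) (jump u)^-1)).
  by apply: choose_id; rewrite /= eqxx ?orbT.
by move=> x /=; rewrite orbC.
Qed.

Lemma positive_jumpV x : positive_jump x -> ~~ positive_jump x^-1.
Proof.
case/and3P=> /asboolP[u <-] j1 /eqP E; apply/negP => /and3P[_ _ /eqP E'].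
have /negP := jump_torsion j1; apply; apply/eqP.
rewrite -[LHS]E -[RHS]E' invgK (@eq_choose _ _ (pred2 (jump u)^-1 (jump u))).
  by apply: choose_id; rewrite /= eqxx ?orbT.
by move=> x0 /=; rewrite orbC.
Qed.

(** Distinct edge orbits outside the spanning subtree have distinct jumps, as
    freeness implies in the end, but taking the set of jumps itself as basis
    avoids having to know this beforehand: the function on edges obtained from
    [f] factors through the jump. *)
Theorem free_of_free_action : free_group G.
Proof.
exists {x : G | positive_jump x}, sval => H f.
pose F x : H := if insub x is Some y then f y
  else if insub x^-1 is Some y then (f y)^-1 else 1.
have F1 : F 1 = 1.
  by rewrite /F invg1; case: insubP => // y /and3P[_]; rewrite eqxx.
have FV x : F x^-1 = (F x)^-1.
  rewrite /F invgK.
  case: (insubP _ x) => [y px _|_]; first by rewrite insubN // positive_jumpV.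
  by case: (insubP _ x^-1) => [y|]; rewrite ?invgK ?invg1.
have [||||phi phiM phi_jump] := @extension H (fun u => F (jump u)).
- by move=> h u; rewrite jumpMl.
- by move=> u; rewrite jump_flip FV.
- by move=> u j pj; rewrite jump_apart //; exact: standard_gen.
- by move=> u ->.
exists phi; split=> [|psi [psiM psif]].
  split=> // -[x px] /=; have /and3P[/asboolP[u xu] _ _] := px.
  by rewrite -[in LHS]xu phi_jump xu /F insubT.
have psi_jump u : psi (jump u) = F (jump u).
  have F_pos x : positive_jump x -> psi x = F x.
    by move=> px; rewrite /F insubT -psif.
  case: (positive_jump_cases u) => [->|/F_pos //|/F_pos].
    by rewrite F1 (morph_one psiM).
  by rewrite FV (morph_inv psiM) => /invg_inj.
have prim chi : {morph chi : x y / x * y} ->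
    (forall u, chi (jump u) = F (jump u)) ->
    is_primitive (fun u => F (jump u)) (fun u => chi (basin u)).
  move=> chiM chi_jump; split=> [|u j oj|u].
  - by rewrite -val1 basin_val (morph_one chiM).
  - by rewrite basinMr //; exact: standard_gen.
  - by rewrite -chi_jump -chiM /jump mulVKg.
apply/funext => h; rewrite -[h]basin_val.
exact: (primitive_unique (prim _ phiM phi_jump) (prim _ psiM psi_jump)).
Qed.

End FreeAction.
End Splitting.

(** * Brunnian twins *)

Section Brunnian.
Local Open Scope group_scope.
Variables (n : nat) (tau : 'I_n.-1).

Lemma nu_standard_apart a : standard (apart tau) a ->
  nu a (gen_right tau) = gen_right tau.
Proof.
case=> w + ->; rewrite nu_of_word.
elim: w => [|j w IHw] /=; first by rewrite /nu_word big_nil perm1.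
case/andP=> pj /IHw {2}<-; rewrite /nu_word big_cons permM; congr (_ _).
apply: val_inj; rewrite /= val_gen_perm /=; move: pj; rewrite /apart /=.
by repeat case: ifP; lia.
Qed.

(** The permutation of [t c] moves the left one of the strands crossing at [t]
    to the right, where [c] leaves it. *)
Lemma pure_not_crossing h u a : nu h = 1 -> standard (apart tau) a ->
  h * u <> u * (twin_gen tau * a).
Proof.
move=> h1 pa /(congr1 (@nu n)); rewrite !nuM h1 mul1g -[LHS]mulg1.
move=> /mulgI /permP/(_ (gen_left tau)); rewrite perm1 permM nu_gen tpermL.
rewrite nu_standard_apart // => /(congr1 val) /=; lia.
Qed.

Hypothesis tau_last : tau.+2 = n.

(** Adding a straight last strand is a homomorphism from [twin n.-1] that is
    inverse to the deletion of that strand. *)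
Lemma standard_other_del a : standard (other tau) a ->
  del (gen_right tau) a = 1 -> a = 1.
Proof.
have [||iota [iotaM iota_gen _]] :=
    @twin_univ n.-1 (twin n) (fun k : 'I_n.-2 => twin_genn n k).
- by move=> k; apply: twin_genn_sqr.
- by move=> k l; apply: twin_genn_comm.
suff inv w : all (other tau) w ->
    iota (del_word (gen_right tau) w) = twin_of_word w.
  by case=> w pw ->; rewrite del_of_word -inv // => ->; rewrite (morph_one iotaM).
elim: w => [_|j w IHw] /=; first by rewrite (morph_one iotaM).
case/andP=> /eqP jt pw; rewrite -cat1s twin_of_wordM.
have ltj : (j.+1 < gen_right tau)%N.
  have := ltn_ord j; rewrite /=; have : j <> tau :> nat by move/val_inj.
  lia.
have -> : gen_perm j (gen_right tau) = gen_right tau.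
  apply: val_inj; rewrite /= val_gen_perm.
  by repeat case: ifP; rewrite /= in ltj *; lia.
rewrite (del_gen_gt (k := Ordinal (del_gen_gt_range ltj))) //.
by rewrite iotaM iota_gen twin_gennE IHw.
Qed.

Lemma Brun_vertex_free (h : Brun n) u a : standard (other tau) a ->
  brun_val h * u = u * a -> h = 1.
Proof.
move=> oa E; have /andP[/eqP h1 /forallP hd] := brun_valP h.
(* The starting position in [u] of the strand that ends last. *)
pose i := (nu u)^-1 (gen_right tau).
have a1 : a = 1.
  apply: standard_other_del => //; apply: (mulgI (del i u)); rewrite mulg1.
  have := congr1 (del i) E; rewrite !delM h1 perm1 (eqP (hd i)) mul1g => {2}->.
  by rewrite /i permKV.
by apply: val_inj; apply: (mulIg u); rewrite /= E a1 mulg1 mul1g.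
Qed.

End Brunnian.

Theorem proposition3p9 (n : nat) (hn : 3 <= n) : free_group (Brun n).
Proof.
have lt_tau : n.-2 < n.-1 by lia.
have tau_last : (Ordinal lt_tau).+2 = n by rewrite /=; lia.
apply: (free_of_free_action (@brun_valM n) (tau := Ordinal lt_tau)).
  exact: Brun_vertex_free tau_last.
move=> h u a pa; apply: pure_not_crossing => //.
by have /andP[/eqP] := brun_valP h.
Qed.
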